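(* Let $n\ge2$, let $(V,\rho,\alpha_V)$ be a representation of a (multiplicative) $n$-Hom-Lie superalgebra $(\mathcal{N},[\cdot,\dots,\cdot],\alpha)$ and let $T:V\to\mathcal{N}$ be an even linear map. Then $T$ is an $\mathcal{O}$-operator on $(\mathcal{N},[\cdot,\dots,\cdot],\alpha)$ with respect to $(V,\rho,\alpha_V)$ if and only if the operator $N_T:\mathcal{N}\oplus V\to\mathcal{N}\oplus V$, $N_T(x+u)=T(u)$ (i.e. $N_T=\begin{bmatrix}0&T\\0&0\end{bmatrix}$), is a Nijenhuis operator on the semi-direct product $n$-Hom-Lie superalgebra $(\mathcal{N}\oplus V,[\cdot,\dots,\cdot]_{\mathcal{N}\oplus V},\alpha+\alpha_V)$.
   Context: Conventions. $\mathbb{K}$ is an algebraically closed field of characteristic $0$; all vector spaces are over $\mathbb{K}$ and $\mathbb{Z}_2$-graded. $|x|$ is the degree of a homogeneous element; formulas involving degrees are for homogeneous elements. For a tuple $X=(x_1,x_2,\dots)$ put $|X|_i^j=\sum_{k=i}^j|x_k|$ (zero if $j<i$), similarly for $Y,U$. A hat means omission. A (multi)linear map is even if it preserves degree. Super-skew-symmetric: exchanging adjacent arguments $x_i,x_{i+1}$ multiplies the value by $-(-1)^{|x_i||x_{i+1}|}$. (Multiplicative) $n$-Hom-Lie superalgebra: $(\mathcal{N},[\cdot,\dots,\cdot],\alpha)$ with $[\cdot,\dots,\cdot]$ an even super-skew-symmetric $n$-linear map, $\alpha$ even linear, $\alpha([x_1,\dots,x_n])=[\alpha(x_1),\dots,\alpha(x_n)]$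 and $[\alpha(x_1),\dots,\alpha(x_{n-1}),[y_1,\dots,y_n]]=\sum_{i=1}^n(-1)^{|X|_1^{n-1}|Y|_1^{i-1}}[\alpha(y_1),\dots,[x_1,\dots,x_{n-1},y_i],\dots,\alpha(y_n)]$. Representation $(V,\rho,\alpha_V)$: $\rho:\mathcal{N}^{n-1}\to gl(V)$ even super-skew-symmetric multilinear, $\alpha_V:V\to V$ even linear with (a) $\rho(\alpha(x_1),\dots,\alpha(x_{n-1}))\alpha_V=\alpha_V\rho(x_1,\dots,x_{n-1})$; (b) $\rho(\alpha(x_1),\dots,\alpha(x_{n-1}))\rho(y_1,\dots,y_{n-1})-(-1)^{|X|_1^{n-1}|Y|_1^{n-1}}\rho(\alpha(y_1),\dots,\alpha(y_{n-1}))\rho(x_1,\dots,x_{n-1})=\sum_{i=1}^{n-1}(-1)^{|X|_1^{n-1}|Y|_1^{i-1}}\rho(\alpha(y_1),\dots,[x_1,\dots,x_{n-1},y_i],\dots,\alpha(y_{n-1}))\alpha_V$; (c) $\rho(\alpha(x_1),\dots,\alpha(x_{n-2}),[y_1,\dots,y_n])\alpha_V=\sum_{i=1}^n(-1)^{n-i}(-1)^{|X|_1^{n-2}(|Y|_1^n+|y_i|)+|y_i||Y|_{i+1}^n}\rho(\alpha(y_1),\dots,\widehat{\alpha(y_i)},\dots,\alpha(y_n))\rho(x_1,\dots,x_{n-2},y_i)$. Semi-direct product: $\mathcal{N}\oplus V$ with twisting map $(\alpha+\alpha_V)(x+a)=\alpha(x)+\alpha_V(a)$ and bracket, for homogeneous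 $x_k+a_k$ ($|x_k|=|a_k|$), $[x_1+a_1,\dots,x_n+a_n]_{\mathcal{N}\oplus V}=[x_1,\dots,x_n]+\sum_{k=1}^n(-1)^{n-k}(-1)^{|x_k||X|_{k+1}^n}\rho(x_1,\dots,\widehat{x_k},\dots,x_n)a_k$. $\mathcal{O}$-operator: an even linear map $T:V\to\mathcal{N}$ with $\alpha\circ T=T\circ\alpha_V$ and $[Tu_1,\dots,Tu_n]=T\big(\sum_{i=1}^n(-1)^{n-i}(-1)^{|u_i||U|_{i+1}^n}\rho(Tu_1,\dots,\widehat{Tu_i},\dots,Tu_n)(u_i)\big)$. Nijenhuis operator on an $n$-Hom-Lie superalgebra $(\mathcal{M},[\cdot,\dots,\cdot],\beta)$: an even linear map $N:\mathcal{M}\to\mathcal{M}$ satisfying $[N(x_1),\dots,N(x_n)]=N\big(\sum_{\emptyset\ne I\subseteq\{1,\dots,n\}}N^{|I|-1}[\hat N_I(x_1),\dots,\hat N_I(x_n)]\big)$, where $\hat N_I(x_i)=x_i$ if $i\in I$ and $\hat N_I(x_i)=N(x_i)$ if $i\notin I$ (here $|I|$ is the cardinality of $I$).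
   Formalization: The Nijenhuis side of the equivalence also requires that N_T commutes with the twisting map α+α_V (equivalently αT = Tα_V), because the ''if'' direction is false without it (e.g. zero bracket, ρ = 0, α = id, α_V = 0, T = id). *)

(* Defs.v *)
From HB Require Import structures.
From mathcomp Require Import all_boot all_fingroup all_algebra.

Set Implicit Arguments.
Unset Strict Implicit.
Unset Printing Implicit Defensive.

Import GRing.Theory.
Local Open Scope ring_scope.

(* A Z/2-graded vector space V = V_0 (+) V_1 of arbitrary dimension. The
   decomposition is given by its two projections, [hpart false] onto V_0 and
   [hpart true] onto V_1; the degree of a homogeneous vector is a boolean. *)
Record superspace (K : fieldType) := Superspace {
  ss_sort :> lmodType K;
  hpart : bool -> {linear ss_sort -> ss_sort};
  hpart_sum : forall v, hpart false v + hpart true v = v;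
  hpart_hpart : forall b c v,
    hpart b (hpart c v) = if b == c then hpart c v else 0
}.

Arguments hpart {K s} b : rename.

Section SuperSpaces.
Variable K : fieldType.
Implicit Types U V W : superspace K.

Definition homog V (b : bool) (v : V) : Prop := hpart b v = v.

Definition even_map V W (f : V -> W) : Prop :=
  forall b v, homog b v -> homog b (f v).

Section DirectSum.
Variables V W : superspace K.

Definition dsum_hpart (b : bool) (w : (V * W)%type) : (V * W)%type :=
  (hpart b w.1, hpart b w.2).

Lemma dsum_hpart_linear b : linear (dsum_hpart b).
Proof. by move=> a u v; rewrite /dsum_hpart /= !linearP. Qed.

HB.instance Definition _ b :=
  GRing.isLinear.Build K (V * W)%type (V * W)%type _ (dsum_hpart b)
    (dsum_hpart_linear b).

Lemma dsum_hpart_sum w : dsum_hpart false w + dsum_hpart true w = w.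
Proof. by case: w => x y; congr pair; apply: hpart_sum. Qed.

Lemma dsum_hpart_hpart b c w :
  dsum_hpart b (dsum_hpart c w) = if b == c then dsum_hpart c w else 0.
Proof. by rewrite /dsum_hpart /= !hpart_hpart; case: eqP. Qed.

Definition dsum : superspace K :=
  @Superspace K (V * W)%type (fun b => dsum_hpart b)
    dsum_hpart_sum dsum_hpart_hpart.

End DirectSum.

End SuperSpaces.

(* Families (x_1, ..., x_m) are finite functions on 'I_m: the 1-based index i
   is the ordinal of value i - 1, so that n - i below is [n - k.+1]. *)
Section Families.
Variables (T T' : Type) (m : nat).

Definition fmap (f : T -> T') (x : {ffun 'I_m -> T}) : {ffun 'I_m -> T'} :=
  [ffun k => f (x k)].

Definition upd (x : {ffun 'I_m -> T}) (i : 'I_m) (z : T) : {ffun 'I_m -> T} :=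
  [ffun k => if k == i then z else x k].

Definition omit (i : 'I_m) (x : {ffun 'I_m -> T}) : {ffun 'I_m.-1 -> T} :=
  [ffun k => x (lift i k)].

(* (x_1, ..., x_{m-1}, z) *)
Definition snoc (x : {ffun 'I_m.-1 -> T}) (z : T) : {ffun 'I_m -> T} :=
  [ffun k : 'I_m => oapp x z (insub (val k))].

End Families.

(* |X|_1^m, |X|_1^{i-1} and |X|_{i+1}^m, as natural numbers: they are only used
   as exponents of -1, or through their parity. *)
Definition degs m (d : {ffun 'I_m -> bool}) : nat := (\sum_(k < m) d k)%N.
Definition degs_before m (d : {ffun 'I_m -> bool}) (i : 'I_m) : nat :=
  (\sum_(k < m | (k < i)%N) d k)%N.
Definition degs_after m (d : {ffun 'I_m -> bool}) (i : 'I_m) : nat :=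
  (\sum_(k < m | (i < k)%N) d k)%N.

Section MultilinearMaps.
Variables (K : fieldType) (m : nat).

Definition multilinear (V W : lmodType K) (f : {ffun 'I_m -> V} -> W) : Prop :=
  forall i x a u v,
    f (upd x i (a *: u + v)) = a *: f (upd x i u) + f (upd x i v).

Definition homogs (V : superspace K) (d : {ffun 'I_m -> bool})
    (x : {ffun 'I_m -> V}) : Prop :=
  forall k, homog (d k) (x k).

Definition even_multi (V W : superspace K) (f : {ffun 'I_m -> V} -> W) : Prop :=
  forall d x, homogs d x -> homog (odd (degs d)) (f x).

Definition super_skew (V : superspace K) (W : lmodType K)
    (f : {ffun 'I_m -> V} -> W) : Prop :=
  forall d x (i j : 'I_m), homogs d x -> j = i.+1 :> nat ->
    f [ffun k => x (tperm i j k)] = - ((-1) ^+ (d i * d j) *: f x).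

End MultilinearMaps.

Section HomLie.
Variables (K : fieldType) (n : nat) (N : superspace K).
Variables (br : {ffun 'I_n -> N} -> N) (al : {linear N -> N}).

Record nHomLie_superalgebra : Prop := {
  nHL_multilinear : multilinear br;
  nHL_even : even_multi br;
  nHL_skew : super_skew br;
  nHL_twist_even : even_map al;
  nHL_multiplicative : forall x, al (br x) = br (fmap al x);
  nHL_identity :
    forall dx (x : {ffun 'I_n.-1 -> N}) dy (y : {ffun 'I_n -> N}),
    homogs dx x -> homogs dy y ->
    br (snoc (fmap al x) (br y)) =
    \sum_(i < n) (-1) ^+ (degs dx * degs_before dy i) *:
      br (upd (fmap al y) i (br (snoc x (y i))))
}.

Variable V : superspace K.

(* gl(V) carries the pointwise vector space structure, and its degree b part
   consists of the endomorphisms mapping each V_c into V_{b + c}. *)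
Record representation (rho : {ffun 'I_n.-1 -> N} -> {linear V -> V})
    (alV : {linear V -> V}) : Prop := {
  rep_multilinear : forall v, multilinear (fun x => rho x v);
  rep_even : forall d x b v, homogs d x -> homog b v ->
    homog (odd (degs d) (+) b) (rho x v);
  rep_skew : forall v, super_skew (fun x => rho x v);
  rep_twist_even : even_map alV;
  rep_twist : forall x v, rho (fmap al x) (alV v) = alV (rho x v);
  rep_commutator :
    forall dx (x : {ffun 'I_n.-1 -> N}) dy (y : {ffun 'I_n.-1 -> N}) v,
    homogs dx x -> homogs dy y ->
    rho (fmap al x) (rho y v) -
      (-1) ^+ (degs dx * degs dy) *: rho (fmap al y) (rho x v) =
    \sum_(i < n.-1) (-1) ^+ (degs dx * degs_before dy i) *:
      rho (upd (fmap al y) i (br (snoc x (y i)))) (alV v);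
  rep_bracket :
    forall dx (x : {ffun 'I_n.-2 -> N}) dy (y : {ffun 'I_n -> N}) v,
    homogs dx x -> homogs dy y ->
    rho (snoc (fmap al x) (br y)) (alV v) =
    \sum_(i < n) (-1) ^+ (n - i.+1) *:
      ((-1) ^+ (degs dx * (degs dy + dy i) + dy i * degs_after dy i) *:
        rho (omit i (fmap al y)) (rho (snoc x (y i)) v))
}.

End HomLie.

Section SemiDirect.
Variables (K : fieldType) (n : nat) (N V : superspace K).
Variables (br : {ffun 'I_n -> N} -> N) (al : {linear N -> N}).
Variables (rho : {ffun 'I_n.-1 -> N} -> {linear V -> V}).
Variable alV : {linear V -> V}.

(* The sum, over k, of
   (-1)^(n-k) (-1)^(|x_k| |X|_{k+1}^n) rho(x_1, ..^.., x_n) a_k,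
   for x_k and a_k homogeneous of degree d_k. *)
Definition rho_sum (d : {ffun 'I_n -> bool}) (x : {ffun 'I_n -> N})
    (a : {ffun 'I_n -> V}) : V :=
  \sum_(k < n) (-1) ^+ (n - k.+1) *:
    ((-1) ^+ (d k * degs_after d k) *: rho (omit k x) (a k)).

(* The multilinear extension of the formula for homogeneous arguments: sum over
   all the ways to replace each argument by one of its homogeneous parts. *)
Definition semidirect_bracket (w : {ffun 'I_n -> dsum N V}) : dsum N V :=
  (br [ffun k => (w k).1],
   \sum_(d : {ffun 'I_n -> bool})
     rho_sum d [ffun k => hpart (d k) (w k).1] [ffun k => hpart (d k) (w k).2]).

Lemma semidirect_bracket_homog d (w : {ffun 'I_n -> dsum N V}) :
  (forall v, multilinear (fun x => rho x v)) -> homogs d w ->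
  semidirect_bracket w =
    (br [ffun k => (w k).1],
     rho_sum d [ffun k => (w k).1] [ffun k => (w k).2]).
Proof.
move=> rho_lin hw; congr pair.
have hw1 k : hpart (d k) (w k).1 = (w k).1 by have /(congr1 fst) := hw k.
have hw2 k : hpart (d k) (w k).2 = (w k).2 by have /(congr1 snd) := hw k.
rewrite (bigD1 d) //= [X in _ + X]big1 ?addr0.
  by congr rho_sum; apply/ffunP => k; rewrite !ffunE ?hw1 ?hw2.
move=> e ne; rewrite /rho_sum big1 // => k _.
have [j nj] : exists j, e j != d j.
  apply/existsP; rewrite -[X in is_true X]negbK negb_exists.
  apply/negP => /forallP h; case/eqP: ne; apply/ffunP => j.
  by apply/eqP; have := h j; rewrite negbK.
rewrite !ffunE; case: (unliftP k j) nj => [j' ->|->] nj; last first.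
  by rewrite -hw2 hpart_hpart (negPf nj) linear0 !scaler0.
set x := omit _ _; set v := hpart _ _.
have <- : upd x j' 0 = x.
  apply/ffunP=> i; rewrite ffunE; case: eqP => // ->.
  by rewrite !ffunE -hw1 hpart_hpart (negPf nj).
have := rho_lin v j' x 1 0 0; rewrite scaler0 addr0 scale1r => /eqP.
by rewrite -subr_eq0 opprD addrA subrr add0r oppr_eq0 => /eqP->; rewrite !scaler0.
Qed.

Definition semidirect_twist (w : dsum N V) : dsum N V := (al w.1, alV w.2).

Record O_operator (T : {linear V -> N}) : Prop := {
  O_even : even_map T;
  O_twist : forall u, al (T u) = T (alV u);
  O_bracket : forall d (u : {ffun 'I_n -> V}), homogs d u ->
    br (fmap T u) = T (rho_sum d (fmap T u) u)
}.

End SemiDirect.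

Section Nijenhuis.
Variables (K : fieldType) (n : nat) (M : superspace K).

(* This notion does not involve a twisting map: commutation of P with one is
   a separate condition. *)
Record Nijenhuis_operator (br : {ffun 'I_n -> M} -> M) (P : {linear M -> M}) :
    Prop := {
  Nij_even : even_map P;
  Nij_bracket : forall x : {ffun 'I_n -> M},
    br (fmap P x) =
    P (\sum_(I : {set 'I_n} | I != set0)
         iter #|I|.-1 P (br [ffun i => if i \in I then x i else P (x i)]))
}.

End Nijenhuis.

Section BlockOperator.
Variables (K : fieldType) (N V : superspace K) (T : {linear V -> N}).

(* The block operator [[0, T], [0, 0]], x + u |-> T u. *)
Definition N_op (w : dsum N V) : dsum N V := (T w.2, 0).

Lemma N_op_linear : linear N_op.
Proof.
by move=> a u v; congr pair; rewrite /= ?linearP // scaler0 addr0.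
Qed.

HB.instance Definition _ :=
  GRing.isLinear.Build K (dsum N V) (dsum N V) _ N_op N_op_linear.

End BlockOperator.

(* Main.v *)
(** Since N_T o N_T = 0, only the singletons I contribute to the Nijenhuis
    identity; the bracket attached to I = {i} then contributes the i-th term of
    the sum in the O-operator identity, so the Nijenhuis identity says
    [Tu_1, ..., Tu_n] = T (sum_i ...) for arbitrary u_1, ..., u_n, the right-hand
    side being extended multilinearly from homogeneous arguments. Both sides being
    multilinear, it is enough to know this identity for homogeneous arguments. *)
Require Import Defs.
From HB Require Import structures.
From mathcomp Require Import all_boot all_fingroup all_algebra.

Set Implicit Arguments.
Unset Strict Implicit.
Unset Printing Implicit Defensive.

Import GRing.Theory.
Local Open Scope ring_scope.

Lemma homog_hpart (K : fieldType) (V : superspace K) b (v : V) :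
  homog b (hpart b v).
Proof. by rewrite /homog hpart_hpart eqxx. Qed.

(** [f] sends each homogeneous part of [v] into the component of the same degree, so projecting
    [f v] to degree [b] keeps only the image of that part. *)
Lemma even_hpart (K : fieldType) (V W : superspace K) (f : {linear V -> W}) :
  even_map f -> forall b v, hpart b (f v) = f (hpart b v).
Proof.
move=> f_even b v; rewrite -{1}(hpart_sum v) !linearD /=.
rewrite -(f_even false _ (homog_hpart _ _)) -(f_even true _ (homog_hpart _ _)).
by case: b; rewrite !hpart_hpart /= ?add0r ?addr0 f_even //; apply: homog_hpart.
Qed.

Lemma upd_id (T : Type) m (x : {ffun 'I_m -> T}) i : upd x i (x i) = x.
Proof. by apply/ffunP => k; rewrite ffunE; case: eqP => // ->. Qed.

Section Multilinear.
Variables (K : fieldType) (m : nat).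

Lemma multilinearD (V W : lmodType K) (f : {ffun 'I_m -> V} -> W) i
    (x : {ffun 'I_m -> V}) u v :
  multilinear f -> f (upd x i (u + v)) = f (upd x i u) + f (upd x i v).
Proof. by move=> f_lin; have := f_lin i x 1 u v; rewrite !scale1r. Qed.

Lemma multilinear0 (V W : lmodType K) (f : {ffun 'I_m -> V} -> W) i
    (x : {ffun 'I_m -> V}) :
  multilinear f -> x i = 0 -> f x = 0.
Proof.
move=> f_lin xi0; have := multilinearD i x 0 0 f_lin.
rewrite addr0 -{1 2 3}xi0 upd_id => /eqP.
by rewrite -subr_eq0 opprD addNKr oppr_eq0 => /eqP.
Qed.

(** Slots are released from homogeneity one at a time: an arbitrary entry is the sum of its two
    homogeneous parts, and both maps are additive in that slot. *)
Lemma multilinear_homog_ext (V : superspace K) (W : lmodType K)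
    (f g : {ffun 'I_m -> V} -> W) :
  multilinear f -> multilinear g ->
  (forall d x, homogs d x -> f x = g x) -> f =1 g.
Proof.
move=> f_lin g_lin fg x.
(* The first [j] entries are arbitrary, the others homogeneous; at [j = m] no condition is left. *)
suff fg_upto j : forall y : {ffun 'I_m -> V},
    (forall k : 'I_m, (j <= k)%N -> exists b, homog b (y k)) -> f y = g y.
  by apply: (fg_upto m) => k; rewrite leqNgt ltn_ord.
elim: j => [|j IHj] y y_homog.
  (* Degrees are read off by a decidable test: odd when the odd projection fixes the entry (so 0
     counts as odd), even otherwise. *)
  apply: (fg [ffun k => hpart true (y k) == y k]) => k; rewrite ffunE.
  case: eqP => // ny; have [[] // yk] := y_homog k isT.
have [ltjm|lemj] := ltnP j m; last first.
  by apply: IHj => k; rewrite leqNgt (leq_trans (ltn_ord k)).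
pose i := Ordinal ltjm.
rewrite -(upd_id y i) -(hpart_sum (y i)) !multilinearD //.
have upd_homog b (k : 'I_m) : (j <= k)%N ->
    exists c, homog c (upd y i (hpart b (y i)) k).
  rewrite ffunE; case: eqP => [_ _|/eqP nki lejk].
    by exists b; apply: homog_hpart.
  by apply: y_homog; rewrite ltn_neqAle lejk andbT eq_sym.
by rewrite !IHj // => k; apply: upd_homog.
Qed.

(** Both sides are multilinear, so homogeneous [x] suffice; there every family other than the
    degrees of [x] puts a zero in some slot. *)
Lemma multilinear_hpart_sum (V : superspace K) (W : lmodType K)
    (f : {ffun 'I_m -> V} -> W) (x : {ffun 'I_m -> V}) :
  multilinear f ->
  f x = \sum_(d : {ffun 'I_m -> bool}) f [ffun k => hpart (d k) (x k)].
Proof.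
move=> f_lin; move: x; apply: multilinear_homog_ext => //.
  move=> i x a u v; rewrite scaler_sumr -big_split; apply: eq_bigr => d _ /=.
  have hpart_upd z : [ffun k => hpart (d k) (upd x i z k)]
      = upd [ffun k => hpart (d k) (x k)] i (hpart (d i) z).
    by apply/ffunP => k; rewrite !ffunE; case: eqP => // ->.
  by rewrite !hpart_upd linearP f_lin.
move=> d x x_homog; rewrite (bigD1 d) //= big1 ?addr0.
  by congr f; apply/ffunP => k; rewrite ffunE x_homog.
move=> e ned; have [j nj] : exists j, e j != d j.
  apply/existsP; apply: contraNT ned; rewrite negb_exists => /forallP ed.
  by apply/eqP/ffunP => j; apply/eqP; rewrite -[_ == _]negbK.
apply: (multilinear0 (i := j)) => //.
by rewrite ffunE -x_homog hpart_hpart (negPf nj).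
Qed.

End Multilinear.

Lemma big_set_le1 (R : nmodType) (I : finType) (F : {set I} -> R) :
  (forall A : {set I}, (1 < #|A|)%N -> F A = 0) ->
  \sum_(A : {set I} | A != set0) F A = \sum_(i : I) F [set i].
Proof.
(* The right-hand sum is reindexed along the injection of [I] into its singletons. *)
move=> F0; rewrite -(big_imset F (h := set1) (A := I)) /=; last first.
  by move=> i j _ _; apply: set1_inj.
rewrite (bigID (fun A : {set I} => #|A| == 1%N)) /= [X in _ + X]big1 ?addr0.
  apply: eq_bigl => A; rewrite -cards_eq0; apply/andP/imsetP.
    by case=> _ /cards1P[i ->]; exists i.
  by case=> i _ ->; rewrite cards1.
by move=> A; rewrite -cards_eq0; case: #|A| (F0 A) => [|[|k]] // ->.
Qed.

Section BlockNijenhuis.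
Variables (K : fieldType) (n : nat) (N V : superspace K).
Variables (br : {ffun 'I_n -> N} -> N).
Variables (rho : {ffun 'I_n.-1 -> N} -> {linear V -> V}).
Variable T : {linear V -> N}.
Implicit Types w : {ffun 'I_n -> dsum N V}.

Lemma N_op_sqr (w : dsum N V) : N_op T (N_op T w) = 0.
Proof. by rewrite /N_op linear0. Qed.

Lemma semidirect_bracket_N_op w :
  semidirect_bracket br rho (fmap (N_op T) w) =
  (br [ffun k => T (w k).2], 0).
Proof.
congr pair; first by congr br; apply/ffunP => k; rewrite !ffunE.
rewrite big1 // => d _; rewrite /rho_sum big1 // => k _.
by rewrite !ffunE !linear0.
Qed.

(** Slot [i] alone has a nonzero [V]-component, so only the summand [k = i] survives, and [omit i]
    leaves just the entries T(u_k). *)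
Lemma semidirect_bracket_N_op_but w i :
  (semidirect_bracket br rho
     [ffun k => if k \in [set i] then w k else N_op T (w k)]).2 =
  \sum_(d : {ffun 'I_n -> bool}) (-1) ^+ (n - i.+1) *:
    ((-1) ^+ (d i * degs_after d i) *:
      rho (omit i [ffun k => hpart (d k) (T (w k).2)]) (hpart (d i) (w i).2)).
Proof.
apply: eq_bigr => d _; rewrite /rho_sum (bigD1 i) //= [X in _ + X]big1 ?addr0.
  rewrite !ffunE inE eqxx; congr (_ *: (_ *: rho _ _)).
  by apply/ffunP => k; rewrite !ffunE inE eq_sym (negPf (neq_lift _ _)).
by move=> k nki; rewrite !ffunE inE (negPf nki) !linear0.
Qed.

Lemma Nijenhuis_sum_N_op w :
  N_op T (\sum_(I : {set 'I_n} | I != set0) iter #|I|.-1 (N_op T)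
    (semidirect_bracket br rho
      [ffun i => if i \in I then w i else N_op T (w i)])) =
  (T (semidirect_bracket br rho [ffun k => (T (w k).2, (w k).2)]).2, 0).
Proof.
rewrite linear_sum big_set_le1; last first.
  (* For |I| >= 2 the outer [N_op T] meets at least one more copy from [iter], and the square is
     zero. *)
  by move=> I; case: #|I| => [|[|k]] // _; apply: N_op_sqr.
under eq_bigr => i _ do rewrite cards1.
rewrite -linear_sum; congr (T _, _).
rewrite (big_morph (fun w : dsum N V => w.2) (id1 := 0) (op1 := +%R)) //.
under eq_bigr => i _ do rewrite semidirect_bracket_N_op_but.
(* With the sum over degrees outermost, the inner sum over [i] is [rho_sum] at the vectors T(u_k) +
   u_k. *)
rewrite exchange_big /=; apply: eq_bigr => d _.
rewrite /rho_sum; apply: eq_bigr => i _; rewrite !ffunE /=.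
by congr (_ *: (_ *: rho (omit i _) _)); apply/ffunP => k; rewrite !ffunE.
Qed.

(** Both sides of the Nijenhuis identity have zero [V]-component and depend on [w] only through its
    [V]-components. *)
Lemma N_op_Nijenhuis_bracketP :
  (forall w, semidirect_bracket br rho (fmap (N_op T) w) =
    N_op T (\sum_(I : {set 'I_n} | I != set0) iter #|I|.-1 (N_op T)
      (semidirect_bracket br rho
        [ffun i => if i \in I then w i else N_op T (w i)]))) <->
  (forall u : {ffun 'I_n -> V}, br (fmap T u) =
    T (semidirect_bracket br rho [ffun k => (T (u k), u k)]).2).
Proof.
split=> [Nij u|O w]; last first.
  rewrite semidirect_bracket_N_op Nijenhuis_sum_N_op; congr pair.
  have -> : [ffun k => T (w k).2] = fmap T [ffun k => (w k).2].
    by apply/ffunP => k; rewrite !ffunE.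
  rewrite O; congr (T (semidirect_bracket _ _ _).2).
  by apply/ffunP => k; rewrite !ffunE.
pose w : {ffun 'I_n -> dsum N V} := [ffun k => (0, u k)].
have wE k : (w k).2 = u k by rewrite ffunE.
have := congr1 fst (Nij w); rewrite semidirect_bracket_N_op Nijenhuis_sum_N_op.
under eq_ffun => k do rewrite wE.
move=> brT; apply: etrans brT _; congr (T (semidirect_bracket _ _ _).2).
by apply/ffunP => k; rewrite !ffunE.
Qed.

Hypothesis br_lin : multilinear br.
Hypothesis rho_lin : forall v, multilinear (fun x => rho x v).
Hypothesis T_even : even_map T.

Lemma O_bracket_homogP :
  (forall d (u : {ffun 'I_n -> V}), homogs d u ->
    br (fmap T u) = T (rho_sum rho d (fmap T u) u)) <->
  (forall u : {ffun 'I_n -> V}, br (fmap T u) =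
    T (semidirect_bracket br rho [ffun k => (T (u k), u k)]).2).
Proof.
split=> [O u|O d u u_homog].
  rewrite (multilinear_hpart_sum _ br_lin) linear_sum; apply: eq_bigr => d _ /=.
  pose ud := [ffun k => hpart (d k) (u k)].
  have -> : [ffun k => hpart (d k) (fmap T u k)] = fmap T ud.
    by apply/ffunP => k; rewrite !ffunE even_hpart.
  (* The identity is applied to each homogeneous piece [ud]; evenness of [T] has moved the
     projections inside [T]. *)
  rewrite (O d) => [|k]; last by rewrite ffunE; apply: homog_hpart.
  by congr (T (rho_sum _ _ _ _)); apply/ffunP => k; rewrite !ffunE ?even_hpart.
rewrite O (@semidirect_bracket_homog _ _ _ _ _ _ d) //= => [|k].
  by congr (T (rho_sum _ _ _ _)); apply/ffunP => k; rewrite !ffunE.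
(* T(u_k) has the degree of u_k, so T(u_k) + u_k is homogeneous. *)
by rewrite ffunE; congr pair; [apply: T_even|]; apply: u_homog.
Qed.

Lemma even_N_op : even_map (N_op T).
Proof.
by move=> b w /(congr1 snd) w_homog; congr pair; rewrite ?linear0 //; apply: T_even.
Qed.

End BlockNijenhuis.

Theorem proposition2p8 (K : closedFieldType) (charK0 : [pchar K] =i pred0)
    (n : nat) (n_ge2 : (2 <= n)%N)
    (N : superspace K) (br : {ffun 'I_n -> N} -> N) (al : {linear N -> N})
    (HN : nHomLie_superalgebra br al)
    (V : superspace K) (rho : {ffun 'I_n.-1 -> N} -> {linear V -> V})
    (alV : {linear V -> V}) (HV : representation br al rho alV)
    (T : {linear V -> N}) (T_even : even_map T) :
  O_operator br al rho alV T <->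
  (Nijenhuis_operator (semidirect_bracket br rho) (N_op T) /\
   forall w : dsum N V,
     N_op T (semidirect_twist al alV w) = semidirect_twist al alV (N_op T w)).
Proof.
have br_lin := nHL_multilinear HN; have rho_lin := rep_multilinear HV.
split=> [[_ O_tw O_br]|[[_ Nij] tw]].
  split=> [|w]; last by rewrite /N_op /semidirect_twist /= O_tw linear0.
  split; first exact: even_N_op.
  exact/N_op_Nijenhuis_bracketP/(O_bracket_homogP br_lin rho_lin T_even).
split=> // [u|].
  (* Evaluating the commutation with the twist at 0 + u recovers [al (T u) = T (alV u)]. *)
  by have /(congr1 fst) := tw (0, u).
exact/(O_bracket_homogP br_lin rho_lin T_even)/N_op_Nijenhuis_bracketP.
Qed.
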